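(* Let $A$ be a nonrecursive c.e. $D$-maximal set of Type 1, 2, or 3. Then the many-one degree of $A$ contains a least finite-one degree, i.e. there is $C\equiv_{\rm m}A$ with $C\le_{\rm fo}B$ for every $B\equiv_{\rm m}A$.
   Context: All sets are subsets of $\omega$; $X\subseteq^* Y$ means $X\setminus Y$ is finite. $A\le_{\rm m}B$: there is total computable $f$ with $x\in A\iff f(x)\in B$; $\equiv_{\rm m}$ is mutual $\le_{\rm m}$. $A\le_{\rm fo}B$: there is total computable $g$ with $x\in A\iff g(x)\in B$ and every fibre $g^{-1}(\{y\})$ finite. A noncomputable c.e. set $A$ is $D$-maximal if for every c.e. $W\supseteq A$, either $W\setminus A$ is c.e. or there is a computable $R$ with $A\subseteq R\subseteq W$. For a c.e. set $A$, $\mathcal D(A)$ is the family of all c.e. sets disjoint from $A$; a finite or countable family $\{G_i:i\in I\}$ of c.e. sets disjoint from $A$ generates $\mathcal D(A)$ if every c.e. set $D$ disjoint from $A$ satisfies $D\subseteq^*\bigcup_{i\in F}G_i$ for some finite $F\subseteq I$. A generating family is of Type 1 if it is $\{\varnothing\}$; of Type 2 if it is $\{R\}$ with $R$ an infinite computable set; of Type 3 if it is $\{W\}$ with $W$ an infinite noncomputable c.e. set. A c.e. set $A$ is of Type $n$ if $\mathcal D(A)$ has a generating family of Type $n$ and no generating family of Type $m$ for any $m<n$. *)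

(* Defs.v *)
From mathcomp Require Import all_boot.
From mathcomp Require Import boolp classical_sets functions cardinality.

Set Implicit Arguments.
Unset Strict Implicit.
Unset Printing Implicit Defensive.

Local Open Scope classical_set_scope.

(* Kleene's mu-recursive functions: [recfun n] is the syntax of the n-ary
   partial recursive functions. *)
Inductive recfun : nat -> Type :=
| RZero n : recfun n
| RSucc : recfun 1
| RProj n (i : 'I_n) : recfun n
| RComp m n (f : recfun m) (gs : 'I_m -> recfun n) : recfun n
| RPrim n (f : recfun n) (g : recfun n.+2) : recfun n.+1
| RMu n (f : recfun n.+1) : recfun n.

(* Graph of the function h given by h(0, v) = f(v) and
   h(k + 1, v) = g(k, h(k, v), v), where F and G are the graphs of f and g. *)
Fixpoint prim_graph n (F : n.-tuple nat -> nat -> Prop)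
    (G : n.+2.-tuple nat -> nat -> Prop) (k : nat) (v : n.-tuple nat)
    (y : nat) : Prop :=
  if k is k'.+1 then
    exists2 z, prim_graph F G k' v z & G [tuple of k' :: z :: v] y
  else F v y.

(* [reval c v y]: the partial function coded by c converges on v with value y.
   In the case of RMu, all values below the least zero have to converge. *)
Fixpoint reval n (c : recfun n) : n.-tuple nat -> nat -> Prop :=
  match c in recfun n return n.-tuple nat -> nat -> Prop with
  | RZero _ => fun _ y => y = 0
  | RSucc => fun v y => y = (thead v).+1
  | RProj _ i => fun v y => y = tnth v i
  | RComp m _ f gs => fun v y =>
      exists2 w : m.-tuple nat,
        (forall i, reval (gs i) v (tnth w i)) & reval f w y
  | RPrim _ f g => fun v y =>
      prim_graph (reval f) (reval g) (thead v) [tuple of behead v] y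
  | RMu _ f => fun v y =>
      reval f [tuple of y :: v] 0 /\
      forall z, z < y -> exists k, reval f [tuple of z :: v] k.+1
  end.

Definition computable (f : nat -> nat) : Prop :=
  exists c : recfun 1, forall x, reval c [tuple x] (f x).

Definition computable_set (A : set nat) : Prop :=
  exists2 f, computable f &
    forall x, (A x -> f x = 1) /\ (~ A x -> f x = 0).

Definition ce (A : set nat) : Prop :=
  A = set0 \/ exists2 f, computable f & A = range f.

Definition almost_subset (X Y : set nat) : Prop := finite_set (X `\` Y).

Definition m_reducible (A B : set nat) : Prop :=
  exists2 f, computable f & forall x, A x <-> B (f x).

Definition m_equivalent (A B : set nat) : Prop :=
  m_reducible A B /\ m_reducible B A.

Definition fo_reducible (A B : set nat) : Prop :=
  exists g, [/\ computable g, forall x, A x <-> B (g x)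
    & forall y, finite_set (g @^-1` [set y])].

Definition d_maximal (A : set nat) : Prop :=
  [/\ ce A, ~ computable_set A
    & forall W, ce W -> A `<=` W ->
        ce (W `\` A) \/
        exists R, [/\ computable_set R, A `<=` R & R `<=` W]].

(* The family called D(A) in the literature. *)
Definition ce_disjoint (A : set nat) : set (set nat) :=
  [set D | ce D /\ D `&` A = set0].

(* Families are represented by their sets of members: repetitions in an indexed
   family do not affect whether it generates. *)
Definition generates (G : set (set nat)) (A : set nat) : Prop :=
  [/\ countable G, G `<=` ce_disjoint A
    & forall D, ce_disjoint A D ->
        exists F : set (set nat), [/\ finite_set F, F `<=` G
          & almost_subset D (\bigcup_(X in F) X)]].

(* Only the first three types of the classification are defined. *)
Inductive family_type : nat -> set (set nat) -> Prop :=
| FamilyType1 : family_type 1 [set set0]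
| FamilyType2 R : computable_set R -> infinite_set R ->
    family_type 2 [set R]
| FamilyType3 W : ce W -> ~ computable_set W -> infinite_set W ->
    family_type 3 [set W].

Definition has_family_of_type (A : set nat) (n : nat) : Prop :=
  exists2 G, family_type n G & generates G A.

(* Meaningful for n = 1, 2, 3 only. *)
Definition set_of_type (n : nat) (A : set nat) : Prop :=
  [/\ ce A, has_family_of_type A n
    & forall m, m < n -> ~ has_family_of_type A m].

(* Main.v *)
(* If D(A) is generated by W, then D-maximality makes every computable U satisfy
   U c* A u W or ~U c* A u W (c* is inclusion up to a finite set). For types 1
   and 3 take C = A; for type 2, W is computable and disjoint from A, so
   C = A u W has the same many-one degree and satisfies the same dichotomy with
   the empty set in the role of W.
   Let f be a many-one reduction of C to B and let U be the computable set of
   those x whose value f x was already taken by some y < x. If ~U c* C u W, then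
   all but finitely many f-fibres have their first point in C or W; a fibre that
   meets neither C nor W therefore is one of finitely many, each of them finite
   modulo W, and f^-1 (f W) is also c* W. Hence the complement of C u W is
   finite, and C is computable by Post's theorem. So U c* C u W. Off U, f is
   injective; on U one can decide (up to finitely many points) whether x is in C
   or in W, and send it to a value >= x in the infinite sets f C or f W. *)
Require Import Defs.
From mathcomp Require Import all_boot.
From mathcomp Require Import boolp classical_sets functions cardinality.
From mathcomp Require Import zify.

Set Implicit Arguments.
Unset Strict Implicit.
Unset Printing Implicit Defensive.

Local Open Scope classical_set_scope.

(** * Closure properties of the recursive functions *)

(** Arguments are untyped lists, constrained only at length [n], so that compositions need no
    dependent lengths. *)
Definition recursive n (F : seq nat -> nat) : Prop :=
  exists c : recfun n, forall v : n.-tuple nat, reval c v (F v).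

Lemma eq_recursive n F G :
  (forall v, size v = n -> F v = G v) -> recursive n F -> recursive n G.
Proof.
by move=> FG [c cF]; exists c => v; rewrite -FG ?size_tuple.
Qed.

Lemma recursive_succ : recursive 1 (fun v => (nth 0 v 0).+1).
Proof. by exists RSucc => v /=; rewrite /thead (tnth_nth 0). Qed.

Lemma recursive_nth n i : i < n -> recursive n (fun v => nth 0 v i).
Proof.
by move=> lt_in; exists (RProj (Ordinal lt_in)) => v /=; rewrite (tnth_nth 0).
Qed.

Lemma recursive_comp m n F (G : 'I_m -> seq nat -> nat) :
  recursive m F -> (forall i, recursive n (G i)) ->
  recursive n (fun v => F [seq G i v | i <- enum 'I_m]).
Proof.
move=> [c cF] /choice[cs csG]; exists (RComp c cs) => v /=.
exists [tuple of [seq G i v | i <- ord_tuple m]]; last exact: cF.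
by move=> i; rewrite tnth_map tnth_ord_tuple.
Qed.

Lemma recursive_comp1 n h F :
  recursive 1 (fun v => h (nth 0 v 0)) -> recursive n F ->
  recursive n (fun v => h (F v)).
Proof.
move=> rech recF.
apply: eq_recursive (recursive_comp rech (fun=> recF)) => v _.
by rewrite enum_ordSl.
Qed.

Lemma recursive_comp2 n h F G :
  recursive 2 (fun v => h (nth 0 v 0) (nth 0 v 1)) ->
  recursive n F -> recursive n G -> recursive n (fun v => h (F v) (G v)).
Proof.
move=> rech recF recG.
have recFG (i : 'I_2) : recursive n (if i == 0 :> nat then F else G).
  by case: eqP.
apply: eq_recursive (recursive_comp rech recFG) => v _.
by rewrite !enum_ordSl.
Qed.

Lemma recursive_const n k : recursive n (fun=> k).
Proof.
elim: k => [|k IHk]; first by exists (RZero n).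
exact: recursive_comp1 recursive_succ IHk.
Qed.

(** [RPrim] recurses on the head of its vector; composing it with the vector [K v :: v] allows any
    recursive bound [K]. *)
Lemma recursive_prim n F G K :
  recursive n F -> recursive n.+2 G -> recursive n K ->
  recursive n (fun v => iteri (K v) (fun k z => G [:: k, z & v]) (F v)).
Proof.
move=> [c cF] [d dG] recK.
have recFG : recursive n.+1
    (fun v => iteri (head 0 v) (fun k z => G [:: k, z & behead v])
                    (F (behead v))).
  exists (RPrim c d) => v; rewrite /= /thead (tnth_nth 0) /= -nth0.
  elim: (nth 0 v 0) => [|k IHk] /=; first exact: (cF [tuple of behead v]).
  eexists; first exact: IHk.
  exact: (dG [tuple of k :: _ :: [tuple of behead v]]).
have recKv (i : 'I_n.+1) :
    recursive n (if i is Ordinal i'.+1 _ then fun v => nth 0 v i' else K).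
  by case: i => -[|i] //= lt_in; apply: recursive_nth.
apply: eq_recursive (recursive_comp recFG recKv) => v sz_v.
rewrite enum_ordSl /= -map_comp.
by rewrite (map_comp (nth 0 v) val) val_enum_ord -sz_v [map _ _]mkseq_nth.
Qed.

Lemma recursive_pred n F : recursive n F -> recursive n (fun v => (F v).-1).
Proof.
move=> recF; have rec0 := recursive_const n 0.
(* The step returns the counter and ignores the accumulator, so the last of [F v] rounds leaves
   [(F v).-1]. *)
have recnth := recursive_nth (isT : 0 < n.+2).
by apply: eq_recursive (recursive_prim rec0 recnth recF) => v _; case: (F v).
Qed.

Lemma recursive_sub n F G :
  recursive n F -> recursive n G -> recursive n (fun v => F v - G v).
Proof.
move=> recF recG.
have recnth := recursive_pred (recursive_nth (isT : 1 < n.+2)).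
apply: eq_recursive (recursive_prim recF recnth recG) => v _.
by elim: (G v) => [|k /= ->]; rewrite ?subn0 ?subnS.
Qed.

Lemma recursive_add n F G :
  recursive n F -> recursive n G -> recursive n (fun v => F v + G v).
Proof.
move=> recF recG.
have recnth :=
  recursive_comp1 recursive_succ (recursive_nth (isT : 1 < n.+2)).
apply: eq_recursive (recursive_prim recF recnth recG) => v _.
by elim: (G v) => [|k /= ->]; rewrite ?addn0 ?addnS.
Qed.

Lemma recursive_negb n (b : seq nat -> bool) :
  recursive n (fun v => b v) -> recursive n (fun v => ~~ b v).
Proof.
move=> recb; apply: eq_recursive (recursive_sub (recursive_const n 1) recb).
by move=> v _; case: (b v).
Qed.

Lemma recursive_andb n (b c : seq nat -> bool) :
  recursive n (fun v => b v) -> recursive n (fun v => c v) ->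
  recursive n (fun v => b v && c v).
Proof.
move=> recb /recursive_negb recc.
(* With truth values as 0 and 1, conjunction is the truncated difference [b - ~~ c]. *)
apply: eq_recursive (recursive_sub recb recc) => v _.
by case: (b v) (c v) => [] [].
Qed.

Lemma recursive_orb n (b c : seq nat -> bool) :
  recursive n (fun v => b v) -> recursive n (fun v => c v) ->
  recursive n (fun v => b v || c v).
Proof.
move=> /recursive_negb recb /recursive_negb recc.
apply: eq_recursive (recursive_negb (recursive_andb recb recc)) => v _.
by rewrite negb_and !negbK.
Qed.

Lemma recursive_leq n F G :
  recursive n F -> recursive n G -> recursive n (fun v => F v <= G v).
Proof.
move=> recF recG.
apply: eq_recursive
  (recursive_sub (recursive_const n 1) (recursive_sub recF recG)) => v _.
by rewrite /leq; case: (F v - G v).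
Qed.

Lemma recursive_eq n F G :
  recursive n F -> recursive n G -> recursive n (fun v => F v == G v).
Proof.
move=> recF recG.
apply: eq_recursive
  (recursive_andb (recursive_leq recF recG) (recursive_leq recG recF)) => v _.
by rewrite eqn_leq.
Qed.

(** Turns a function of [v] into a step function for [recursive_prim], whose vector begins with
    counter and accumulator. *)
Lemma recursive_behead2 n F :
  recursive n F -> recursive n.+2 (fun v => F (behead (behead v))).
Proof.
move=> recF.
have recv (i : 'I_n) : recursive n.+2 (fun v => nth 0 v i.+2).
  by apply: recursive_nth; rewrite !ltnS.
apply: eq_recursive (recursive_comp recF recv) => -[|a [|b v]] //= [sz_v].
by rewrite (map_comp (nth 0 v) val) val_enum_ord -sz_v [map _ _]mkseq_nth.
Qed.

Lemma recursive_mul n F G :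
  recursive n F -> recursive n G -> recursive n (fun v => F v * G v).
Proof.
move=> recF recG.
have recFG := recursive_add (recursive_behead2 recF)
                            (recursive_nth (isT : 1 < n.+2)).
apply: eq_recursive (recursive_prim (recursive_const n 0) recFG recG) => v _.
by elim: (G v) => [|k /= ->]; rewrite ?muln0 ?mulnS.
Qed.

(** The condition is used as a number of rounds: zero rounds keep [G v], one round replaces it by
    [F v]. *)
Lemma recursive_if n (b : seq nat -> bool) F G :
  recursive n (fun v => b v) -> recursive n F -> recursive n G ->
  recursive n (fun v => if b v then F v else G v).
Proof.
move=> recb /recursive_behead2 recF recG.
by apply: eq_recursive (recursive_prim recG recF recb) => v _; case: (b v).
Qed.

Lemma recursive_mu n F :
  recursive n.+1 F -> (forall v, exists y, F (y :: v) == 0) ->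
  exists2 m, recursive n m &
    forall v, F (m v :: v) = 0 /\ forall y, F (y :: v) = 0 -> m v <= y.
Proof.
move=> [c cF] exF; exists (fun v => ex_minn (exF v)).
  exists (RMu c) => v /=; case: ex_minnP => y /eqP Fy0 ymin; split.
    by rewrite -[X in reval _ _ X]Fy0; apply: cF.
  (* [RMu] wants earlier values to be successors; this one is nonzero by minimality of [y]. *)
  move=> z lt_zy; exists (F (z :: v)).-1.
  have := cF [tuple of z :: v]; rewrite /=; case Fz: (F (z :: v)) => [|k] //.
  by move/eqP: Fz => /ymin; rewrite leqNgt lt_zy.
by move=> v; case: ex_minnP => y /eqP Fy0 ymin; split=> // z /eqP /ymin.
Qed.

(** * Unary and binary computable functions, search and pairing *)

Lemma computableE f : computable f <-> recursive 1 (fun v => f (nth 0 v 0)).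
Proof.
split=> -[c cf]; exists c; last by move=> x; apply: (cf [tuple x]).
case/tupleP=> x v; rewrite (tuple0 v).
rewrite (_ : [tuple of x :: [tuple]] = [tuple x]); first exact: cf.
exact: val_inj.
Qed.

Definition computable2 (f : nat -> nat -> nat) : Prop :=
  recursive 2 (fun v => f (nth 0 v 0) (nth 0 v 1)).

Lemma recursive_computable n f F :
  computable f -> recursive n F -> recursive n (fun v => f (F v)).
Proof. by move=> /computableE; apply: recursive_comp1. Qed.

Lemma recursive_computable2 n f F G :
  computable2 f -> recursive n F -> recursive n G ->
  recursive n (fun v => f (F v) (G v)).
Proof. exact: recursive_comp2. Qed.

Lemma computable_comp f g :
  computable f -> computable g -> computable (f \o g).
Proof.
move=> cf /computableE cg; apply/computableE; exact: recursive_computable cf cg.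
Qed.

Lemma computable_mu (b : nat -> nat -> bool) :
  computable2 b -> (forall x, exists y, b x y) ->
  exists2 m, computable m &
    forall x, b x (m x) /\ forall y, b x y -> m x <= y.
Proof.
move=> recb exb.
(* Minimization searches for a zero in the head position, hence the negation and the swapped
   arguments. *)
have recN : recursive 2 (fun v => ~~ b (nth 0 v 1) (nth 0 v 0)).
  apply: recursive_negb.
  by apply: (recursive_computable2 recb); apply: recursive_nth.
have exN v : exists y, (~~ b (nth 0 (y :: v) 1) y : nat) == 0.
  by have [y bxy] := exb (nth 0 v 0); exists y; rewrite /= bxy.
have [m [c cm] mP] := recursive_mu recN exN.
exists (fun x => m [:: x]); first by exists c => x; apply: (cm [tuple x]).
move=> x; have [/=] := mP [:: x]; case: (b _ _) => // _ mmin; split=> // y bxy.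
by apply: mmin; rewrite bxy.
Qed.

(* [e n] is the excess of n over the largest square below it, and n codes the
   pair (e n, e (sqrt n)); the coding is onto but not injective. *)
Lemma computable_unpair : exists l r : nat -> nat,
  [/\ computable l, computable r & forall a b, exists n, l n = a /\ r n = b].
Proof.
have recb : computable2 (fun n q => n < q.+1 * q.+1).
  have rec1 := recursive_comp1 recursive_succ (recursive_nth (isT : 1 < 2)).
  apply: recursive_leq (recursive_mul rec1 rec1).
  exact: recursive_comp1 recursive_succ (recursive_nth (isT : 0 < 2)).
have [n|q cq qP] := computable_mu recb.
  by exists n; rewrite mulSn addSn ltnS leq_addr.
pose e n := n - q n * q n.
have qE s a : a <= s -> q (s * s + a) = s.
  move=> le_as; have [lt_q q_min] := qP (s * s + a).
  apply/eqP; rewrite eqn_leq q_min /=; last by nia.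
  rewrite leqNgt; apply/negP => lt_qs; move: lt_q; rewrite ltnNge => /negP[].
  by rewrite (leq_trans (leq_mul lt_qs lt_qs)) ?leq_addr.
have ce : computable e.
  apply/computableE;
  have recq := recursive_computable cq (recursive_nth (isT : 0 < 1)).
  exact: recursive_sub (recursive_nth _) (recursive_mul recq recq).
exists e, (e \o q); split=> //; first exact: computable_comp.
(* [s] has integer root [a + b] and excess [b]; since [a <= s], the number [s * s + a] has root [s]
   and excess [a]. *)
move=> a b; pose s := (a + b) * (a + b) + b.
have le_as : a <= s by rewrite /s; nia.
exists (s * s + a); rewrite /= qE // /e qE // addKn; split=> //.
by rewrite /s qE ?leq_addl // addKn.
Qed.

(** * Computably enumerable and computable sets *)

(** Membership becomes a search for a stage [s] passing a decidable test, a form that suits unions,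
    preimages and parallel search. *)
Lemma ceP A : ce A <-> exists2 b : nat -> nat -> bool,
  computable2 b & forall x, A x <-> exists s, b x s.
Proof.
split=> [[->|[f cf ->]]|[b cb bP]].
- exists (fun _ _ => false); first exact: recursive_const.
  by move=> x; split=> // -[].
- exists (fun x s => f s == x).
    apply: recursive_eq; last exact: recursive_nth.
    exact: recursive_computable cf (recursive_nth _).
  by move=> x; split=> [[s _ <-]|[s /eqP <-]]; exists s.
have [[a Aa]|A0] := pselect (exists a, A a); last first.
  by left; rewrite -subset0 => a Aa; apply: A0; exists a.
have [l [r [cl cr lrP]]] := computable_unpair.
(* Enumerate over coded pairs of a point and a stage; the element [a] is the default output when the
   test fails. *)
right; exists (fun n => if b (l n) (r n) then l n else a).
  apply/computableE;
  have recl := recursive_computable cl (recursive_nth (isT : 0 < 1)).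
  apply: recursive_if; [|exact: recl|exact: recursive_const].
  apply: (recursive_computable2 cb recl).
  exact: recursive_computable cr (recursive_nth _).
apply/seteqP; split=> [x /bP[s bxs]|_ [n _ <-]].
  by have [n [ln rn]] := lrP x s; exists n => //; rewrite ln rn bxs.
by case: ifP => // bn; apply/bP; exists (r n).
Qed.

Lemma computable_setE S : computable_set S <-> computable (fun x => `[< S x >]).
Proof.
split=> [[f cf fP]|cS]; last first.
  exists (fun x => `[< S x >]) => // x.
  by split=> Sx; [rewrite asboolT|rewrite asboolF].
rewrite (_ : (fun x => _) = f) //; apply/funext => x.
by have [f1 f0] := fP x; case: asboolP => [/f1|/f0].
Qed.

Lemma computable_setC S : computable_set S -> computable_set (~` S).
Proof.
move=> /computable_setE/computableE cS; apply/computable_setE/computableE.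
by apply: eq_recursive (recursive_negb cS) => v _; rewrite asbool_neg.
Qed.

Lemma computable_setI S T :
  computable_set S -> computable_set T -> computable_set (S `&` T).
Proof.
move=> /computable_setE/computableE cS /computable_setE/computableE cT.
apply/computable_setE/computableE.
by apply: eq_recursive (recursive_andb cS cT) => v _; rewrite asbool_and.
Qed.

Lemma computable_setD S T :
  computable_set S -> computable_set T -> computable_set (S `\` T).
Proof.
by rewrite setDE => cS cT; apply: computable_setI (computable_setC cT).
Qed.

Lemma computable_finite_set S : finite_set S -> computable_set S.
Proof.
move=> /finite_seqP[s ->]; apply/computable_setE/computableE.
rewrite (_ : (fun v => _) = fun v => nth 0 v 0 \in s :> nat); last first.
  by apply/funext => v; rewrite asboolb.
elim: s => [|a s IHs]; first exact: recursive_const.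
apply: (@recursive_orb 1 _ (fun v => nth 0 v 0 \in s)) IHs.
apply: recursive_eq; [exact: recursive_nth|exact: recursive_const].
Qed.

Lemma computable_preimage f S :
  computable f -> computable_set S -> computable_set (f @^-1` S).
Proof.
move=> cf /computable_setE cS; apply/computable_setE.
exact: (computable_comp cS cf).
Qed.

Lemma ce_computable S : computable_set S -> ce S.
Proof.
move=> /computable_setE cS; apply/ceP; exists (fun x _ => `[< S x >]).
  exact: recursive_computable cS (recursive_nth _).
by move=> x; split=> [Sx|[_ /asboolP]//]; exists 0; apply/asboolP.
Qed.

Lemma ceU X Y : ce X -> ce Y -> ce (X `|` Y).
Proof.
move=> /ceP[b cb bP] /ceP[c cc cP]; apply/ceP.
exists (fun x s => b x s || c x s); first exact: recursive_orb.
move=> x; split=> [[/bP[s bs]|/cP[s cs]]|[s /orP[bs|cs]]].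
- by exists s; rewrite bs.
- by exists s; rewrite cs orbT.
- by left; apply/bP; exists s.
- by right; apply/cP; exists s.
Qed.

Lemma ce_preimage f X : computable f -> ce X -> ce (f @^-1` X).
Proof.
move=> cf /ceP[b cb bP]; apply/ceP; exists (fun x s => b (f x) s).
  apply: (recursive_computable2 cb (recursive_computable cf _));
    exact: recursive_nth.
by move=> x; apply: bP.
Qed.

Lemma ce_image f X : computable f -> ce X -> ce (f @` X).
Proof.
move=> cf [->|[e ce ->]]; first by left; rewrite image_set0.
by right; exists (f \o e); [exact: computable_comp|rewrite image_comp].
Qed.

(** Post's theorem: search for a stage accepting [x] for either set, then see which test succeeded
    there. *)
Lemma ce_ceC_computable S : ce S -> ce (~` S) -> computable_set S.
Proof.
move=> /ceP[b cb bP] /ceP[c cc cP].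
have cbc : computable2 (fun x s => b x s || c x s) by exact: recursive_orb.
have [x|m cm mP] := computable_mu cbc.
  have [/bP[s bs]|/cP[s cs]] := pselect (S x); exists s; first by rewrite bs.
  by rewrite cs orbT.
apply/computable_setE/computableE.
apply: eq_recursive (recursive_computable2 cb (recursive_nth (isT : 0 < 1))
  (recursive_computable cm (recursive_nth (isT : 0 < 1)))) => v _.
have [bc _] := mP (nth 0 v 0); congr nat_of_bool; apply/idP/asboolP => [bx|].
  by apply/bP; exists (m (nth 0 v 0)).
by case/orP: bc => // cx Sx; case: (iffRL (cP _) _ Sx); exists (m (nth 0 v 0)).
Qed.

(** * Unbounded choices, repeated values and splitting of computable sets *)

Lemma infinite_set_unbounded (X : set nat) n :
  infinite_set X -> exists2 x, X x & n <= x.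
Proof.
move=> infX; apply: contrapT => bX; apply: infX.
apply: sub_finite_set (finite_II n) => x Xx /=.
by rewrite ltnNge; apply/negP => le_nx; apply: bX; exists x.
Qed.

(** [d x] is found by running through an enumeration of [X]. The bound [x <= d x] is what keeps
    fibres finite later. *)
Lemma ce_unbounded_choice X : ce X -> infinite_set X ->
  exists2 d, computable d & forall x, X (d x) /\ x <= d x.
Proof.
case=> [->|[e ce ->]] infX; first by case: infX; apply: finite_set0.
have [||m cm mP] := @computable_mu (fun x s => x <= e s).
- apply: recursive_leq (recursive_nth _) (recursive_computable ce _) => //.
  exact: recursive_nth.
- move=> x; have [_ [s _ <-] le_xs] := infinite_set_unbounded x infX.
  by exists s.
exists (e \o m); first exact: computable_comp.
by move=> x; have [le_xm _] := mP x; split=> //; exists (m x).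
Qed.

(** Bounded search by primitive recursion: the vector holds the candidate [y], the truth value so
    far, and [x]. On the complement of this set [f] is injective. *)
Lemma computable_fibre_repeat f :
  computable f -> computable_set [set x | exists2 y, y < x & f y = f x].
Proof.
move=> cf; apply/computable_setE/computableE.
have rec0 := recursive_nth (isT : 0 < 1).
have recG : recursive 3
    (fun v => (f (nth 0 v 0) == f (nth 0 v 2)) || (nth 0 v 1 != 0)).
  apply: recursive_orb; last first.
    apply: recursive_negb; apply: recursive_eq (recursive_const _ _).
    exact: recursive_nth.
  apply: recursive_eq; apply: recursive_computable cf _; exact: recursive_nth.
have recE := recursive_prim (recursive_const 1 0) recG rec0.
apply: eq_recursive recE => -[|x [|//]] //= _.
pose r k := [exists y : 'I_k, f y == f x].
suff -> k :
    iteri k (fun k z => ((f k == f x) || (z != 0)) : nat) 0 = r k.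
  congr nat_of_bool; apply/existsP/asboolP => [[y /eqP fy]|[y lt_yx /eqP fy]].
    by exists y.
  by exists (Ordinal lt_yx).
elim: k => [|k /= ->]; first by rewrite /r; case: existsP => // -[[]].
congr nat_of_bool; rewrite eqb0 negbK /r; apply/idP/existsP.
  case/orP=> [fk|/existsP[y fy]]; first by exists ord_max.
  by exists (widen_ord (leqnSn k) y).
case=> y fy; case: (ltnP y k) => [lt_yk|le_ky].
  by apply/orP; right; apply/existsP; exists (Ordinal lt_yk).
have yk : y = k :> nat by apply/eqP; rewrite eqn_leq le_ky -ltnS ltn_ord.
by rewrite -{1}yk fy.
Qed.

Lemma ceI_computable S X : computable_set S -> ce X -> ce (S `&` X).
Proof.
move=> /computable_setE cS /ceP[b cb bP]; apply/ceP.
exists (fun x s => `[< S x >] && b x s).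
  apply: recursive_andb cb; exact: recursive_computable cS (recursive_nth _).
move=> x; split=> [[Sx /bP[s bs]]|[s /andP[/asboolP Sx bs]]].
  by exists s; rewrite asboolT.
by split=> //; apply/bP; exists s.
Qed.

(** Inside [S] the sets [C] and [W] are complementary, so the complement of [S] together with the
    part of [S] in [W] enumerates the complement of [S] meet [C]. *)
Lemma computable_setI_split C W S :
  ce C -> ce W -> C `&` W = set0 -> computable_set S -> S `<=` C `|` W ->
  computable_set (S `&` C).
Proof.
move=> cC cW CW0 cS SCW; apply: ce_ceC_computable; first exact: ceI_computable.
suff -> : ~` (S `&` C) = ~` S `|` W `&` S.
  apply: ceU; first exact/ce_computable/computable_setC.
  by rewrite setIC; apply: ceI_computable.
apply/seteqP; split=> x.
  move=> nSC; have [Sx|] := pselect (S x); last by left.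
  by right; split=> //; case: (SCW _ Sx) => // Cx; case: nSC.
by case=> [nSx [/nSx]//|[Wx _] [_ Cx]]; have : set0 x by rewrite -CW0.
Qed.

(** * From many-one to finite-one reductions *)

Lemma m_reducible_trans A B C :
  m_reducible A B -> m_reducible B C -> m_reducible A C.
Proof.
move=> [f cf fP] [g cg gP]; exists (g \o f); first exact: computable_comp.
by move=> x; rewrite fP gP.
Qed.

(** Allowing [W] to be empty covers types 1 and 2; if it is not, noncomputability makes its image
    under [f] infinite. *)
Lemma fo_reducible_of_dichotomy C W B :
    ce C -> ~ computable_set C -> ce W -> C `&` W = set0 ->
    W = set0 \/ ~ computable_set W ->
    (forall D, ce_disjoint C D -> almost_subset D W) ->
    (forall U, computable_set U ->
       almost_subset U (C `|` W) \/ almost_subset (~` U) (C `|` W)) ->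
  m_reducible C B -> fo_reducible C B.
Proof.
move=> cC nC cW CW0 W0 CD dich [f cf fP].
have CW x : C x -> W x -> False.
  by move=> Cx Wx; have : set0 x by rewrite -CW0.
(* Such a preimage is c.e. and disjoint from [C], so the generator [W] almost contains it. *)
have fibre_ce Y : ce Y -> Y `<=` ~` B -> finite_set (f @^-1` Y `\` W).
  move=> cY YB; apply: CD; split; first exact: ce_preimage.
  by rewrite -subset0 => x [/YB nB] /fP.
have fWB : f @` W `<=` ~` B by move=> _ [x Wx <-] /fP /CW; apply.
have [b cb bP] : exists2 b, computable b & forall x, B (b x) /\ x <= b x.
  (* The image of [C] is infinite: otherwise [C], being the preimage of its image, would be
     computable. *)
  have [|b cb bP] := ce_unbounded_choice (ce_image cf cC).
    move=> /computable_finite_set/(computable_preimage cf) cfC; apply: nC.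
    congr computable_set: cfC; apply/seteqP; split=> [x [y /fP By fyx]|x Cx].
      by apply/fP; rewrite -fyx.
    by exists x.
  by exists b => // x; have [[y /fP By <-]] := bP x.
have [d cd dP] :
    exists2 d, computable d & forall x, W x -> ~ B (d x) /\ x <= d x.
  (* For empty [W] the requirement is vacuous and [b] is an arbitrary computable function. *)
  case: W0 => [->|nW]; first by exists b.
  (* W differs finitely from f^-1 (f W), computable if f W were finite. *)
  have [|d cd dP] := ce_unbounded_choice (ce_image cf cW).
    move=> finfW; apply: nW.
    have cfW := computable_preimage cf (computable_finite_set finfW).
    have finD := fibre_ce _ (ce_image cf cW) fWB.
    have := computable_setD cfW (computable_finite_set finD).
    rewrite setDD setIC; congr computable_set; apply/setIidl => x Wx.
    by exists x.
  by exists d => // x _; have [/fWB] := dP x.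
pose U := [set x | exists2 y, y < x & f y = f x].
have cU : computable_set U := computable_fibre_repeat cf.
have finU : finite_set (U `\` (C `|` W)).
  case: (dich U cU) => // finT; exfalso; apply: nC.
  suff finN : finite_set (~` (C `|` W)).
    apply: ce_ceC_computable => //.
    suff -> : ~` C = W `|` ~` (C `|` W).
      by apply: ceU => //; apply: ce_computable; apply: computable_finite_set.
    apply/seteqP; split=> x; last first.
      by case=> [Wx /CW|nCW Cx]; [apply|apply: nCW; left].
    move=> nCx; have [Wx|nWx] := pselect (W x); first by left.
    by right; case.
  set T := ~` U `\` (C `|` W) in finT.
  (* A point outside [C] and [W] has a fibre that either meets [W] or has its first point in the
     finite set [T]; modulo [W], each of these contributes finitely many points. *)
  pose N := (f @^-1` (f @` W) `\` W) `|`
            \bigcup_(t in T) (f @^-1` [set f t] `\` W).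
  apply: (@sub_finite_set _ _ N).
    move=> x nCW.
    have nWx : ~ W x by move=> Wx; apply: nCW; right.
    have nBx : ~ B (f x) by move=> /fP Cx; apply: nCW; left.
    have [fWx|nfWx] := pselect ((f @` W) (f x)); first by left.
    (* [y] is the first point of the fibre of x; it lies in [T]. *)
    right; have exy : exists y, f y == f x by exists x.
    have [y /eqP fy ymin] := ex_minnP exy.
    exists y; last by split; rewrite /= ?fy.
    split=> [[z lt_zy fz]|[/fP|Wy]].
    - by move: lt_zy; rewrite ltnNge ymin // fz fy.
    - by rewrite fy.
    - by apply: nfWx; exists y.
  rewrite finite_setU; split; first exact: fibre_ce (ce_image cf cW) fWB.
  apply: bigcup_finite => // t [_ nCWt]; apply: fibre_ce.
    exact/ce_computable/computable_finite_set.
  by move=> _ -> /fP Ct; apply: nCWt; left.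
(* [S] is the part of [U] inside [C] or [W], written as [U] minus a finite set to make it
   computable. *)
pose S := U `\` (U `\` (C `|` W)).
have cS : computable_set S by exact: computable_setD (computable_finite_set _).
have SCW : S `<=` C `|` W by rewrite /S setDD => x [].
have cSC := computable_setI_split cC cW CW0 cS SCW.
have cSW : computable_set (S `&` W).
  by apply: computable_setI_split cW cC _ cS _; rewrite 1?setIC // setUC.
pose g x := if `[< (S `&` C) x >] then b x
            else if `[< (S `&` W) x >] then d x else f x.
have cg : computable g.
  apply/computableE; apply: recursive_if; [|exact/computableE|].
    by move/computable_setE/computableE: cSC.
  apply: recursive_if; [|exact/computableE|exact/computableE].
  by move/computable_setE/computableE: cSW.
exists g; split=> // [x|y].
  rewrite /g; case: asboolP => [[_ Cx]|nSC].
    by split=> // _; have [] := bP x.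
  case: asboolP => [[_ Wx]|nSW]; last exact: fP.
  by split=> [/CW/(_ Wx)//|Bdx]; have [] := dP _ Wx.
(* Redirected points of the fibre over [y] are at most [y]; the others are the finitely many
   exceptions in [U] or first points of [f]-fibres. *)
pose V := `I_y.+1 `|` (U `\` (C `|` W)) `|` (~` U `&` f @^-1` [set y]).
apply: (@sub_finite_set _ _ V).
  move=> x /=; rewrite /g; case: asboolP => [_ bxy|nSC].
    by left; left; rewrite /= ltnS -bxy; have [] := bP x.
  case: asboolP => [[_ Wx] dxy|nSW fxy].
    by left; left; rewrite /= ltnS -dxy; have [] := dP _ Wx.
  have [Ux|] := pselect (U x); last by right.
  left; right; split=> // CWx.
  have Sx : S x by rewrite /S setDD.
  by case: CWx => ?; [apply: nSC|apply: nSW].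
rewrite !finite_setU; split; first by split=> //; apply: finite_II.
(* Of two points with the same value the larger lies in [U], so at most one point remains off
   [U]. *)
have [[x [nUx fx]]|V0] := pselect (exists x, (~` U `&` f @^-1` [set y]) x).
  apply: (@sub_finite_set _ _ [set x]); last exact: finite_set1.
  move=> z [nUz fz] /=; apply/eqP; rewrite eqn_leq.
  have fxz : f x = f z by exact: etrans fx (esym fz).
  apply/andP; split; rewrite leqNgt; apply/negP => lt.
    by apply: nUz; exists x.
  by apply: nUx; exists z.
rewrite (_ : _ `&` _ = set0); first exact: finite_set0.
by rewrite -subset0 => x Vx; apply: V0; exists x.
Qed.

(** * D-maximal sets with a single generator *)

(** Apply maximality to the union of [A] and [U]. Either [U] minus [A] is c.e., or the complement of
    [R] is a c.e. set containing every point outside [A] and [U]; both are disjoint from [A], hence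
    almost inside [G]. *)
Lemma d_maximal_dichotomy A G U :
    d_maximal A -> ce G -> (forall D, ce_disjoint A D -> almost_subset D G) ->
    computable_set U ->
  almost_subset U (A `|` G) \/ almost_subset (~` U) (A `|` G).
Proof.
move=> [cA _ maxA] cG AD cU.
have cV : ce (A `|` U) by apply/ceU/ce_computable.
have AV : A `<=` A `|` U by move=> x; left.
have [cVA|[R [cR AR RV]]] := maxA _ cV AV.
  left; apply: sub_finite_set (AD ((A `|` U) `\` A) _) => [x [Ux nAGx]|].
    split; last by move=> Gx; apply: nAGx; right.
    by split; [right|move=> Ax; apply: nAGx; left].
  by split=> //; rewrite -subset0 => x [[_ nAx] /nAx].
right; apply: sub_finite_set (AD (~` R) _) => [x [nUx nAGx]|].
  split=> [/RV[Ax|//]|Gx]; apply: nAGx; [by left|by right].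
split; first exact/ce_computable/computable_setC.
by rewrite -subset0 => x [nRx /AR].
Qed.

Lemma generates1_almost_subset A G D :
  generates [set G] A -> ce_disjoint A D -> almost_subset D G.
Proof.
move=> [_ _ gen] /gen[F [_ FG finD]]; apply: sub_finite_set finD => x [Dx nGx].
by split=> // -[X /FG -> /nGx].
Qed.

Theorem theorem4p6 (A : set nat) (Ace : ce A) (Anc : ~ computable_set A)
    (AD : d_maximal A)
    (At : set_of_type 1 A \/ set_of_type 2 A \/ set_of_type 3 A) :
  exists C : set nat, m_equivalent C A /\
    forall B : set nat, m_equivalent B A -> fo_reducible C B.
Proof.
have refl : m_equivalent A A.
  by split; exists id => //; apply/computableE/recursive_nth.
have caseW W : ce W -> generates [set W] A -> W = set0 \/ ~ computable_set W ->
    exists C : set nat, m_equivalent C A /\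
      forall B : set nat, m_equivalent B A -> fo_reducible C B.
  move=> cW genW W0; exists A; split=> // B [_ AB].
  have [_ /(_ W erefl) [_ WA0] _] := genW.
  have ADW D := @generates1_almost_subset A W D genW.
  apply: (fo_reducible_of_dichotomy Ace Anc cW _ W0 ADW) AB.
    by rewrite setIC.
  by move=> U; apply: d_maximal_dichotomy.
case: At => [[_ [G GT gen] _]|[[_ [G GT gen] _]|[_ [G GT gen] _]]].
- by inversion GT; subst; apply: (caseW set0) => //; left.
- inversion GT as [|R cR infR|]; subst.
  have [_ /(_ R erefl) [_ RA0] _] := gen.
  have ADR D := @generates1_almost_subset A R D gen.
  have ceR := ce_computable cR.
  have RA x : R x -> A x -> False.
    by move=> Rx Ax; have : set0 x by rewrite -RA0.
  have nAR : ~ computable_set (A `|` R).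
    move=> /computable_setD/(_ cR); rewrite setDUl setDv setU0.
    by rewrite (_ : A `\` R = A) //; apply/setDidl; rewrite setIC.
  have [a Aa] : exists a, A a.
    apply: contrapT => A0; apply: Anc; apply: computable_finite_set.
    rewrite (_ : A = set0); first exact: finite_set0.
    by rewrite -subset0 => a Aa; apply: A0; exists a.
  have [e nARe] : exists e, ~ (A `|` R) e.
    apply: contrapT => ARt; apply: nAR.
    rewrite -[X in computable_set X]setCK; apply: computable_setC.
    apply: computable_finite_set.
    rewrite (_ : ~` _ = set0); first exact: finite_set0.
    by rewrite -subset0 => x nARx; apply: ARt; exists x.
  (* Collapsing [R] to one point gives both reductions: [k = e] moves it out of the union, [k = a]
     moves it into [A]. *)
  have cif k : computable (fun x => if `[< R x >] then k else x).
    move/computable_setE/computableE: cR => cR.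
    apply/computableE; apply: (recursive_if cR (recursive_const _ _)).
    exact: recursive_nth.
  have redAR : m_reducible A (A `|` R).
    exists (fun x => if `[< R x >] then e else x); first exact: cif.
    move=> x; case: asboolP => [Rx|nRx]; first by split=> // /(RA _ Rx).
    by split=> [|[]//]; left.
  have redRA : m_reducible (A `|` R) A.
    exists (fun x => if `[< R x >] then a else x); first exact: cif.
    move=> x; case: asboolP => [Rx|nRx]; first by split=> // _; right.
    by split=> [[]//|]; left.
  exists (A `|` R); split=> // B [_ AB].
  apply: (@fo_reducible_of_dichotomy _ set0) => //.
  + exact: ceU.
  + by left.
  + exact: setI0.
  + by left.
  + move=> D [cD DAR0].
    (* [D] is almost contained in [R] and disjoint from it, hence finite. *)
    have : almost_subset D R.
      apply: ADR; split=> //; rewrite -subset0 => x [Dx Ax].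
      by rewrite -DAR0; split=> //; left.
    apply: sub_finite_set => x [Dx _]; split=> // Rx.
    by have : set0 x by rewrite -DAR0; split=> //; right.
  + by move=> U; rewrite setU0; apply: d_maximal_dichotomy.
  + exact: m_reducible_trans redRA AB.
- by inversion GT; subst; apply: (caseW W) => //; right.
Qed.
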